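(* Let $d \ge 1$ be an integer, let $\mathbf{n}, \mathbf{s}\in \mathbb{Z}_{\ge 0}^d$ be integer vectors, and let $\mathcal{R} \subseteq \mathbb{Z}_{\ge 0}^d$ be a non-empty finite family of integer vectors. Suppose that for all $\mathbf{r} \in \mathcal{R}$ and $i \in [d]$ we have $n_i \ge s_i$ and $r_i \ge s_i$. Define the family of hypergraphs $K^{\mathbf{s}}_{\mathcal{R}}:=\{K^{\mathbf{s}}_{\mathbf{r}}\mid \mathbf{r}\in\mathcal{R}\}$ and let $\mathcal{R}(\mathbf{n}) := \{\mathbf{r}\in\mathcal{R} \mid \forall i\in[d]\ \ r_i\le n_i\}$. Then $$\mathrm{c\text{-}wsat}(K^{\mathbf{s}}_{\mathbf{n}}, K^{\mathbf{s}}_{\mathcal{R}}) = \prod_{i\in[d]} \binom{n_i}{s_i} - q(\mathbf{n}, \mathbf{s}, \mathcal{R}),$$ where $$q(\mathbf{n}, \mathbf{s}, \mathcal{R}) = \left|\left\{T \in \prod_{i \in [d]} \binom{[n_i]}{s_i}\ \middle|\ \exists \mathbf{r}\in\mathcal{R}(\mathbf{n})\ \forall i \in [d]\ \ T_i \in \binom{[n_i] \setminus [r_{i} - s_i]}{s_i}\right\}\right|.$$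
   Context: Notation: for an integer $n\ge 1$, $[n]=\{1,\dots,n\}$, and $[n]=\emptyset$ for $n\le 0$. For a finite set $A$ and an integer $k\ge 0$, $\binom{A}{k}$ is the set of all $k$-element subsets of $A$ (and $\binom{A}{k}=\emptyset$ for $k<0$). A hypergraph $G$ has a finite vertex set $V(G)$ and an edge set $E(G)$ which is a set of subsets of $V(G)$ (not necessarily uniform). For $\mathbf{s},\mathbf{r}\in\mathbb{Z}_{\ge0}^d$, the hypergraph $K^{\mathbf{s}}_{\mathbf{r}}$ has vertex set $\bigcup_{i\in[d]}[r_i]\times\{i\}$, and its edges are exactly the vertex subsets $W$ with $|W\cap([r_i]\times\{i\})|=s_i$ for all $i\in[d]$. It is viewed as a $d$-colored hypergraph with the coloring giving every vertex of $[r_i]\times\{i\}$ the color $i$. A $d$-colored hypergraph is a pair $(G,c)$ with $G$ a hypergraph and $c:V(G)\to[d]$ an arbitrary map. A colored copy of $(H,t)$ in $(G,c)$ is a subhypergraph $\widetilde H\subseteq G$ ($V(\widetilde H)\subseteq V(G)$, $E(\widetilde H)\subseteq E(G)$) with coloring $c|_{V(\widetilde H)}$ such that there is a bijection $f:V(\widetilde H)\to V(H)$ with $S\in E(\widetilde H)\iff f(S)\in E(H)$ for all $S\subseteq V(\widetilde H)$ and $c(v)=t(f(v))$ for all $v\in V(\widetilde H)$. Given a $d$-colored hypergraph $(G,c)$ and a non-empty family $\mathcal{H}$ of $d$-colored hypergraphs, a spanning subhypergraph $F$ of $G$ ($V(F)=V(G)$, $E(F)\subseteq E(G)$, with the same coloring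 $c$) is weakly $\mathcal{H}$-saturated in $(G,c)$ if there is an ordering $e_1,\dots,e_k$ of the edges in $E(G)\setminus E(F)$ such that each $e_i$ belongs to a colored copy of some $(H,t)\in\mathcal{H}$ in $(F\cup\{e_1,\dots,e_i\},c)$. The colored weak saturation number $\mathrm{c\text{-}wsat}((G,c),\mathcal{H})$ is the minimum number of edges of such an $F$. *)

(* Defs.v *)
From HB Require Import structures.
From mathcomp Require Import all_boot all_order all_algebra.
From mathcomp Require Import finmap.
From mathcomp Require Import boolp.

Set Implicit Arguments.
Unset Strict Implicit.
Unset Printing Implicit Defensive.

(* The color set [d] is 'I_d, and [m] is 'I_m: the element j of [m] is
   represented by the ordinal j - 1. *)

Record chypergraph (d : nat) := CHypergraph {
  vertex :> finType;
  edges : {set {set vertex}};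
  color : vertex -> 'I_d
}.

Section ColoredWeakSaturation.
Variable d : nat.
Implicit Types G H : chypergraph d.

Definition spanning G (F : {set {set G}}) : chypergraph d :=
  CHypergraph F (@color d G).

(* The bijection is defined on the subtype of V only, so that copies of
   hypergraphs without vertices are allowed. *)
Definition colored_copy G H (V : {set G}) (E : {set {set G}}) : Prop :=
  [/\ E \subset edges G,
      forall e, e \in E -> e \subset V
    & exists f : {v : G | v \in V} -> H,
        [/\ bijective f,
            forall S : {set {v : G | v \in V}},
              ([set val v | v in S] \in E) = ([set f v | v in S] \in edges H)
          & forall v, color (val v) = color (f v)]].

(* Families of hypergraphs are predicates, because set (chypergraph d) from
   classical_sets is ruled out by universe constraints. A spanning
   subhypergraph of G is given by its edge set. *)
Definition weakly_saturated G (HH : chypergraph d -> Prop) (F : {set {set G}}) :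
    Prop :=
  F \subset edges G /\
  exists es : seq {set G},
    perm_eq es (enum (edges G :\: F)) /\
    forall i, i < size es ->
      exists2 H, HH H &
        exists (V : {set G}) (E : {set {set G}}),
          @colored_copy (spanning (F :|: [set:: take i.+1 es])) H V E /\
          nth set0 es i \in E.

Lemma weakly_saturated_edges G HH : weakly_saturated HH (edges G).
Proof.
split=> //; exists [::]; split=> //.
by rewrite setDv enum_set0.
Qed.

Definition wsat_size G (HH : chypergraph d -> Prop) : pred nat :=
  fun m => `[< exists2 F : {set {set G}}, weakly_saturated HH F & #|F| = m >].

Lemma wsat_size_ex G HH : exists m, wsat_size G HH m.
Proof.
exists #|edges G|; apply/asboolP; exists (edges G) => //.
exact: weakly_saturated_edges.
Qed.

Definition cwsat G (HH : chypergraph d -> Prop) : nat :=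
  ex_minn (wsat_size_ex G HH).

Implicit Types (n s r : {ffun 'I_d -> nat}) (R : {fset {ffun 'I_d -> nat}}).

(* The vertex (j, i) in [r_i] x {i} is Tagged _ j with tag i. *)
Definition complete_chypergraph s r : chypergraph d :=
  @CHypergraph d {i : 'I_d & 'I_(r i)}
    [set W : {set {i : 'I_d & 'I_(r i)}} |
       [forall i, #|W :&: [set v | tag v == i]| == s i]]
    (fun v => tag v).

Definition complete_family s R : chypergraph d -> Prop :=
  fun H => exists2 r, r \in R & H = complete_chypergraph s r.

Definition restrict_family R n : {fset {ffun 'I_d -> nat}} :=
  [fset r in R | [forall i, r i <= n i]]%fset.

Definition ksubsets (T : finType) (A : {set T}) (k : nat) : {set {set T}} :=
  [set B : {set T} | B \subset A & #|B| == k].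

(* The elements of [k] that lie in [m] *)
Definition initial (k m : nat) : {set 'I_k} := [set j : 'I_k | j < m].

Definition q n s R : nat :=
  #|[set T : {dffun forall i : 'I_d, {set 'I_(n i)}} |
      [forall i, T i \in ksubsets [set: 'I_(n i)] (s i)] &&
      [exists r : restrict_family R n,
         [forall i, T i \in
            ksubsets ([set: 'I_(n i)] :\: initial (n i) (val r i - s i)) (s i)]]]|.

End ColoredWeakSaturation.

(* Main.v *)
Require Import Defs.
From mathcomp Require Import all_boot all_order all_algebra.
From mathcomp Require Import fingroup perm finmap.
From mathcomp Require Import boolp.

(* Upper bound: let X be the set of the T counted by q. Remove X from the edge
   set and add its elements back by increasing sum of their vertices. Given T
   in X with witness r, the copy on T together with the first r_i - s_i vertices
   of each color i contains, besides T, only edges with a smaller sum.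

   Lower bound: to a copy of K^s_r on V attach the vector in the tensor product
   of the exterior powers Lambda^{s_i}(Q^{n_i}) which is the Plucker vector of
   the vectors supported on V_i and orthogonal to the first r_i - s_i rows of a
   Vandermonde matrix. Its coordinates are nonzero exactly on the edges inside
   V, so the vectors of the copies completed by successive new edges are
   linearly independent by triangularity. On the other hand, the Vandermonde
   matrices map all of them into the coordinate subspace spanned by X, so at
   most |X| edges are added. The tensor product is realised inside
   Lambda^{s_1 + ... + s_d} of the direct sum of the Q^{n_i}, that is, by
   determinants of matrices whose rows are indexed by all the vertices. *)

Set Implicit Arguments.
Unset Strict Implicit.
Unset Printing Implicit Defensive.

Import GRing.Theory Num.Theory.
Local Open Scope ring_scope.

(** * Determinants, polynomial roots and divided differences *)

Lemma det_mulmx_rowsub (R : comNzRingType) (k m : nat) (A : 'M[R]_(k, m))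
    (B : 'M[R]_(m, k)) :
  \det (A *m B) =
    \sum_(t : {ffun 'I_k -> 'I_m}) (\prod_i A i (t i)) * \det (rowsub t B).
Proof.
under [RHS]eq_bigr do rewrite big_distrr /=.
rewrite exchange_big; apply: eq_bigr => /= s _.
under eq_bigr do rewrite mxE.
rewrite bigA_distr_bigA big_distrr /=; apply: eq_bigr => t _.
rewrite big_split /= mulrCA; congr (_ * (_ * _)).
by apply: eq_bigr => i _; rewrite mxE.
Qed.

Lemma det_neq0_perm (R : idomainType) (k : nat) (A : 'M[R]_k) :
  \det A != 0 -> exists s : 'S_k, forall i, A i (s i) != 0.
Proof.
move=> detA; case: (pickP (fun s : 'S_k => \prod_i A i (s i) != 0)) => [s | A0].
  by move=> /prodf_neq0 As; exists s => i; apply: As.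
case/eqP: detA; apply: big1 => s _.
by move/negbT: (A0 s); rewrite negbK => /eqP->; rewrite mulr0.
Qed.

Lemma inj_same_image_perm (k : nat) (T : finType) (f g : 'I_k -> T) :
    injective f -> f @: setT = g @: setT ->
  exists s : 'S_k, forall i, f i = g (s i).
Proof.
move=> f_inj fg; have /fin_all_exists[h hE] i : exists j, f i = g j.
  have /imsetP[j _ ->] : f i \in g @: setT by rewrite -fg imset_f.
  by exists j.
have h_inj : injective h by move=> i j hij; apply: f_inj; rewrite !hE hij.
by exists (perm h_inj) => i; rewrite permE.
Qed.

Lemma inj_image_exists (k : nat) (T : finType) (A : {set T}) :
  #|A| = k -> exists f : 'I_k -> T, injective f /\ f @: setT = A.
Proof.
move=> <-; exists enum_val; split; first exact: enum_val_inj.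
apply/setP=> x; apply/imsetP/idP => [[i _ ->] | xA]; first exact: enum_valP.
by exists (enum_rank_in xA x); rewrite ?enum_rankK_in.
Qed.

Lemma poly_eq0_roots (R : idomainType) (I : finType) (A : {set I}) (a : I -> R)
    (p : {poly R}) :
    {in A &, injective a} -> (size p <= #|A|)%N ->
  (forall j, j \in A -> p.[a j] = 0) -> p = 0.
Proof.
move=> a_inj szp pa; apply/eqP; apply: contraT => p0.
have := max_poly_roots (rs := map a (enum A)) p0.
rewrite size_map -cardE ltnNge szp; apply.
  by apply/allP=> _ /mapP[j jA ->]; rewrite /root pa // -mem_enum.
rewrite map_inj_in_uniq ?enum_uniq // => x y; rewrite !mem_enum; exact: a_inj.
Qed.

(* The coefficient of degree [#|A| - 1] in the Lagrange interpolation of ['X^k]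
   at the points [a j]. *)
Lemma sum_expr_divided_difference (F : fieldType) (I : finType) (A : {set I})
    (a : I -> F) (k : nat) :
    {in A &, injective a} -> (k.+1 < #|A|)%N ->
  \sum_(j in A) a j ^+ k / \prod_(l in A :\ j) (a j - a l) = 0.
Proof.
move=> a_inj ltkA.
pose w j := \prod_(l in A :\ j) (a j - a l).
pose L j := \prod_(l in A :\ j) ('X - (a l)%:P).
have w_neq0 j : j \in A -> w j != 0.
  move=> jA; apply/prodf_neq0 => l; rewrite !inE subr_eq0 => /andP[lj lA].
  by apply: contraNneq lj => /a_inj ->.
have szL j : j \in A -> size (L j) = #|A|.
  by move=> jA; rewrite /L -big_enum size_prod_XsubC -cardE (cardsD1 j A) jA.
pose p := \sum_(j in A) (a j ^+ k / w j) *: L j - 'X^k.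
have p0 : p = 0.
  apply: (poly_eq0_roots a_inj).
    apply: (leq_trans (size_polyD _ _)); rewrite size_polyN size_polyXn geq_max.
    rewrite (ltnW ltkA) andbT; apply: (leq_trans (size_sum _ _ _)).
    by apply/bigmax_leqP=> j jA; rewrite (leq_trans (size_scale_leq _ _)) ?szL.
  move=> j jA; rewrite /p hornerD hornerN hornerXn horner_sum (bigD1 j) //=.
  rewrite [X in _ + X + _]big1 ?addr0 => [|l /andP[lA lj]].
    rewrite hornerZ horner_prod; under eq_bigr do rewrite hornerXsubC.
    by rewrite divfK ?subrr ?w_neq0.
  rewrite hornerZ horner_prod (bigD1 j) /= ?inE 1?eq_sym ?lj //.
  by rewrite hornerXsubC subrr mul0r mulr0.
(* Each [L j] is monic of degree [#|A| - 1], and ['X^k] has no term of that degree because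
   [k + 1 < #|A|]. *)
have := congr1 (coefp #|A|.-1) p0; rewrite /= coef0 coefB coefXn.
rewrite gtn_eqF; last by rewrite -ltnS (ltn_predK ltkA).
rewrite subr0 coef_sum => sum0; rewrite -[RHS]sum0; apply: eq_bigr => j jA.
rewrite coefZ -{1}(szL j jA) -lead_coefE (eqP (monic_prod_XsubC _ _ _)) mulr1.
by [].
Qed.

(** * Block Vandermonde matrices and circuits *)

Section Circuits.

Variable d : nat.
Implicit Types n s : 'I_d -> nat.

Notation vtx n := {i : 'I_d & 'I_(n i)}.

Definition of_color n (i : 'I_d) : {set vtx n} := [set v | tag v == i].

(** The interpolation point of a vertex is its position in its color class, so vertices of different
    colors may share a point. *)
Definition node n (v : vtx n) : rat := (tagged v : nat)%:R.

Lemma node_inj n (i : 'I_d) : {in @of_color n i &, injective (@node n)}.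
Proof.
move=> [iu u] [iv v]; rewrite !inE => /eqP/= iui /eqP/= ivi.
rewrite {}iui in u *; rewrite {}ivi in v *.
by move=> /eqP; rewrite /node /= eqr_nat => /eqP /val_inj ->.
Qed.

Lemma card_of_color n i : #|of_color n i| = n i.
Proof.
have <- : [set Tagged (fun i => 'I_(n i)) j | j in [set: 'I_(n i)]] = of_color n i.
  apply/setP=> -[i' j]; rewrite inE /=; apply/imsetP/eqP => [[j' _] | e].
    by move/(congr1 (fun v => tag v)).
  by rewrite {}e in j *; exists j; rewrite ?inE.
rewrite card_imset ?cardsT ?card_ord // => j j'.
by move=> /eqP; rewrite eq_Tagged => /eqP.
Qed.

(** The coefficients of color [i] form a polynomial of degree below [s i] vanishing at the distinct
    nodes of [e] of that color, of which there are at least [s i]. *)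
Lemma color_vandermonde_inj n s (e : {set vtx n}) (c : vtx s -> rat) :
    (forall i, s i <= #|e :&: of_color n i|)%N ->
    (forall w, w \in e ->
       \sum_(p | tag p == tag w) c p * node w ^+ (tagged p) = 0) ->
  forall p, c p = 0.
Proof.
move=> le_se sum0 [i j].
pose p : {poly rat} := \sum_(l < s i) c (Tagged _ l) *: 'X^l.
have p0 : p = 0.
  apply: (@poly_eq0_roots _ _ (e :&: of_color n i) (@node n)).
  - by move=> u v /setIP[_ ui] /setIP[_ vi]; apply: node_inj ui vi.
  - apply: leq_trans (le_se i); apply: (leq_trans (size_sum _ _ _)).
    apply/bigmax_leqP=> l _; apply: (leq_trans (size_scale_leq _ _)).
    by rewrite size_polyXn.
  - move=> w /setIP[we]; rewrite inE => /eqP wi.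
    rewrite -(sum0 w we) wi horner_sum.
    pose F i' (l : 'I_(s i')) := c (Tagged (fun i => 'I_(s i)) l) * node w ^+ l.
    transitivity (\sum_(i' | i' == i) \sum_(l : 'I_(s i') | true) F i' l).
      rewrite big_pred1_eq; apply: eq_bigr => l _.
      by rewrite hornerZ hornerXn.
    rewrite (sig_big_dep (pred1 i) (fun i' _ => true) F).
    by apply: eq_big => [[i' l] | [i' l] _] //=; rewrite andbT.
have := congr1 (coefp j) p0; rewrite /= coef0 coef_sum => cj0.
rewrite -[RHS]cj0 (bigD1 j) //= coefZ coefXn eqxx mulr1 big1 ?addr0 // => l lj.
by rewrite coefZ coefXn eq_sym (inj_eq val_inj) (negPf lj) mulr0.
Qed.

(** Block diagonal, one block per color: the position of the row vertex is the exponent, and the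
    column vertex supplies the node. *)
Definition vandermonde n : 'M[rat]_#|{: vtx n}| :=
  \matrix_(x, y) let v : vtx n := enum_val x in let w : vtx n := enum_val y in
    if tag v == tag w then node w ^+ (tagged v) else 0.

(* The columns of color [i] span the space of vectors supported on [V_i] that
   are orthogonal to the first [#|V_i| - s i] rows of color [i] of
   [vandermonde n]. *)
Definition circuit n s (V : {set vtx n}) : 'M[rat]_(#|{: vtx n}|, #|{: vtx s}|) :=
  \matrix_(y, x) let w : vtx n := enum_val y in let p : vtx s := enum_val x in
    if (w \in V) && (tag p == tag w)
    then node w ^+ (tagged p) /
         \prod_(l in (V :&: of_color n (tag w)) :\ w) (node w - node l)
    else 0.

Lemma vandermonde_unit n : vandermonde n \in unitmx.
Proof.
rewrite -row_free_unit; apply: inj_row_free => v vM.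
have v0 : forall p : vtx n, v 0 (enum_rank p) = 0.
  apply: (@color_vandermonde_inj n n setT) => [i | w _].
    by rewrite setTI card_of_color.
  have /rowP/(_ (enum_rank w)) := vM; rewrite !mxE => vMw.
  rewrite -[RHS]vMw big_mkcond (reindex (@enum_val _ {: vtx n})) /=; last first.
    exact/onW_bij/enum_val_bij.
  apply: eq_bigr => x _; rewrite mxE enum_rankK enum_valK /=.
  by case: ifP; rewrite ?mulr0.
by apply/rowP=> x; rewrite -[x]enum_valK v0 mxE.
Qed.

(** * Minors of the circuit matrices and the dimension bound *)

Definition ranks n (W : {set vtx n}) : {set 'I_#|{: vtx n}|} :=
  [set x | enum_val x \in W].

Lemma card_ranks n (W : {set vtx n}) : #|ranks W| = #|W|.
Proof.
have -> : ranks W = enum_rank @: W.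
  apply/setP=> x; rewrite inE; apply/idP/imsetP => [xW | [v vW ->]].
    by exists (enum_val x); rewrite ?enum_valK.
  by rewrite enum_rankK.
exact/card_imset/enum_rank_inj.
Qed.

Lemma card_color_sum n (W : {set vtx n}) :
  #|W| = (\sum_(i < d) #|W :&: of_color n i|)%N.
Proof.
rewrite -sum1_card (partition_big (fun v : vtx n => tag v) xpredT) //=.
apply: eq_bigr => i _; rewrite sum1_card; apply: eq_card => v.
by rewrite !inE.
Qed.

Lemma card_edge n s (W : {set vtx n}) :
  (forall i, #|W :&: of_color n i| = s i) -> #|W| = #|{: vtx s}|.
Proof.
move=> Ws; rewrite card_color_sum -[RHS]cardsT card_color_sum.
by apply: eq_bigr => i _; rewrite Ws setTI card_of_color.
Qed.

(** Up to nonzero factors [1 / D] on its rows, the submatrix on [e] has for each color a Vandermonde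
    block with exponents below [s i] at [s i] distinct nodes. *)
Lemma det_circuit_neq0 n s (V e : {set vtx n})
    (t : 'I_#|{: vtx s}| -> 'I_#|{: vtx n}|) :
    (forall i, #|e :&: of_color n i| = s i) -> e \subset V ->
    t @: setT = ranks e ->
  \det (rowsub t (circuit s V)) != 0.
Proof.
move=> es eV te.
rewrite -det_tr -unitfE -unitmxE -row_free_unit; apply: inj_row_free => v vC.
have v0 : forall p : vtx s, v 0 (enum_rank p) = 0.
  apply: (@color_vandermonde_inj n s e) => [i | w we]; first by rewrite es.
  have /imsetP[q _ qw] : enum_rank w \in t @: setT.
    by rewrite te inE enum_rankK.
  have /rowP/(_ q) := vC; rewrite !mxE => vCq.
  set D := \prod_(l in (V :&: of_color n (tag w)) :\ w) (node w - node l).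
  have D0 : D != 0.
    apply/prodf_neq0 => l /setD1P[lw /setIP[_ lcol]]; rewrite subr_eq0.
    apply: contraNneq lw => lw; rewrite eq_sym.
    by apply/eqP/(node_inj _ lcol lw); rewrite inE.
  apply: (mulIf (invr_neq0 D0)); rewrite mul0r -[RHS]vCq big_distrl /= big_mkcond.
  rewrite (reindex (@enum_val _ {: vtx s})) /=; last exact/onW_bij/enum_val_bij.
  apply: eq_bigr => x _; rewrite !mxE -qw enum_rankK enum_valK /= (subsetP eV) //=.
  by case: ifP; rewrite ?mulr0 ?mulrA.
by apply/rowP=> x; rewrite -[x]enum_valK v0 mxE.
Qed.

Lemma det_circuit_eq0 n s (V e : {set vtx n})
    (t : 'I_#|{: vtx s}| -> 'I_#|{: vtx n}|) :
    ~~ (e \subset V) -> t @: setT = ranks e ->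
  \det (rowsub t (circuit s V)) = 0.
Proof.
case/subsetPn=> w we wV te.
have /imsetP[q _ qw] : enum_rank w \in t @: setT by rewrite te inE enum_rankK.
rewrite (expand_det_row _ q) big1 // => x _.
by rewrite !mxE -qw enum_rankK /= (negPf wV) mul0r.
Qed.

(** For equal colors the entry is the divided difference of ['X^(tagged v + tagged p)] over the
    nodes of [V] of that color. Since [tagged p < s (tag v)], it vanishes for [v] below the
    threshold. *)
Lemma vandermonde_circuit_neq0 n s (V : {set vtx n}) v p :
    (vandermonde n *m circuit s V) (enum_rank v) (enum_rank p) != 0 ->
  tag v = tag p /\
  (#|V :&: of_color n (tag v)| - s (tag v) <= tagged v)%N.
Proof.
rewrite mxE (reindex (@enum_rank {: vtx n})) /=; last exact/onW_bij/enum_rank_bij.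
have [vp | vp] := eqVneq (tag v) (tag p); last first.
  rewrite big1 ?eqxx // => w _; rewrite !mxE !enum_rankK /=.
  case: (tag v =P tag w) => [<-|]; last by rewrite mul0r.
  by rewrite [_ == tag v]eq_sym (negPf vp) andbF mulr0.
move=> neq0; split=> //; rewrite leqNgt; apply: contra neq0 => lt_v.
have ltp : (tagged p < s (tag v))%N by rewrite vp.
set A := V :&: of_color n (tag v) in lt_v *.
have ltA : ((tagged v + tagged p).+1 < #|A|)%N.
  rewrite ltn_subRL in lt_v; apply: leq_trans lt_v.
  by rewrite ltnS addnC -addSn leq_add2r.
have A_inj : {in A &, injective (@node n)}.
  by move=> u w /setIP[_ ui] /setIP[_ wi]; apply: node_inj ui wi.
apply/eqP; rewrite -[RHS](sum_expr_divided_difference A_inj ltA) [RHS]big_mkcond.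
apply: eq_bigr => w _; rewrite !mxE !enum_rankK /=.
have -> : (w \in A) = (w \in V) && (tag v == tag w).
  by rewrite !inE [tag w == _]eq_sym.
have -> : (tag p == tag w) = (tag v == tag w) by rewrite vp.
have [vw | vw] := eqVneq (tag v) (tag w); last by rewrite mul0r andbF.
by rewrite andbT -vw; case: ifP => _; rewrite ?mulr0 // exprD mulrA.
Qed.

(** A nonzero Leibniz term matches every row with a column of its own color through a nonzero entry,
    which forces both the color counts and the thresholds. *)
Lemma det_neq0_edge n s (V : {set vtx n})
    (t : 'I_#|{: vtx s}| -> 'I_#|{: vtx n}|) :
    \det (rowsub t (vandermonde n *m circuit s V)) != 0 ->
  exists W : {set vtx n}, [/\ injective t, t @: setT = ranks W,
    forall i, #|W :&: of_color n i| = s i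
    & forall v, v \in W ->
        (#|V :&: of_color n (tag v)| - s (tag v) <= tagged v)%N].
Proof.
move=> det0; have t_inj : injective t.
  move=> x y txy; apply: contraNeq det0 => xy; apply/eqP.
  by apply: (determinant_alternate xy) => z; rewrite !mxE txy.
have [sg sg0] := det_neq0_perm det0.
have {}sg0 x : tag (enum_val (t x)) = tag (enum_val (sg x)) /\
    (#|V :&: of_color n (tag (enum_val (t x)))| - s (tag (enum_val (t x)))
       <= tagged (enum_val (t x)))%N.
  by apply: vandermonde_circuit_neq0; have := sg0 x; rewrite mxE !enum_valK.
exists [set enum_val (t x) | x in setT]; split=> //.
- apply/setP=> y; rewrite inE; apply/imsetP/imsetP => -[x _ xy]; exists x => //.
    by rewrite xy.
  exact: enum_val_inj.
- move=> i; rewrite -[RHS](card_of_color s).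
  (* [h] sends a column to the row matched with it. It keeps colors, so the selected rows have as
     many vertices of color [i] as there are columns of that color. *)
  pose h p : vtx n := enum_val (t ((sg^-1)%g (enum_rank p))).
  have hinj : injective h.
    by move=> p p' /enum_val_inj /t_inj /perm_inj /enum_rank_inj.
  have htag p : tag (h p) = tag p.
    have [e _] := sg0 ((sg^-1)%g (enum_rank p)).
    by rewrite /h e permKV enum_rankK.
  rewrite -[RHS](card_imset _ hinj); apply: eq_card => v; rewrite inE.
  apply/andP/imsetP => [[/imsetP[x _ vx]] | [p]].
    rewrite inE => vi; exists (enum_val (sg x)).
      by have [e _] := sg0 x; rewrite inE -e -vx.
    by rewrite /h enum_valK permK.
  rewrite !inE => pi ->; rewrite htag; split=> //; exact: imset_f.
- by move=> v /imsetP[x _ ->]; have [] := sg0 x.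
Qed.

(** The two containment hypotheses make the minors of the circuits triangular along [e], while after
    multiplication by the Vandermonde matrix only minors on members of [Q] can be nonzero. *)
Lemma circuits_bound n s (k : nat) (e V : 'I_k -> {set vtx n})
    (Q : {set {set vtx n}}) :
    (forall j i, #|e j :&: of_color n i| = s i) ->
    (forall j, e j \subset V j) ->
    (forall j l : 'I_k, (j < l)%N -> ~~ (e l \subset V j)) ->
    (forall W, W \in Q -> forall i, #|W :&: of_color n i| = s i) ->
    (forall j W, (forall i, #|W :&: of_color n i| = s i) ->
       (forall v, v \in W ->
          (#|V j :&: of_color n (tag v)| - s (tag v) <= tagged v)%N) ->
       W \in Q) ->
  (k <= #|Q|)%N.
Proof.
move=> es eV eVl Qs VQ; rewrite leqNgt; apply/negP=> ltQk.
have rep W : (forall i, #|W :&: of_color n i| = s i) ->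
    exists t : 'I_#|{: vtx s}| -> 'I_#|{: vtx n}|,
      injective t /\ t @: setT = ranks W.
  by move=> Ws; apply: inj_image_exists; rewrite card_ranks (card_edge Ws).
have /fin_all_exists[g gP] (x : 'I_#|Q|) := rep _ (Qs _ (enum_valP x)).
pose MY j := vandermonde n *m circuit s (V j).
pose B := \matrix_(j, x) \det (rowsub (g x) (MY j)).
(* [B] has more rows than columns, which gives a dependency [c] among the minors chosen for [Q]. *)
have [c c0 cB] : exists2 c : 'rV_k, c != 0 & c *m B = 0.
  have : kermx B != 0.
    rewrite kermx_eq0; apply/negP => /eqP Bk.
    by have := rank_leq_col B; rewrite Bk leqNgt ltQk.
  by case/rowV0Pn=> c /sub_kermxP cB c0; exists c.
(* The dependency extends to every choice of rows: a nonzero minor selects some [W] in [Q], and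
   passing to the enumeration chosen for [W] changes all the minors by the same sign. *)
have MY0 t : \sum_j c 0 j * \det (rowsub t (MY j)) = 0.
  case: (pickP (fun j => \det (rowsub t (MY j)) != 0)) => [j | det0]; last first.
    by apply: big1 => j _; move/negbT: (det0 j) => /negPn/eqP->; rewrite mulr0.
  case/det_neq0_edge=> W [t_inj tW Ws VW].
  have WQ := VQ j W Ws VW; have [_] := gP (enum_rank_in WQ W).
  rewrite enum_rankK_in // -tW => gt.
  have [sg sgE] := inj_same_image_perm t_inj (esym gt).
  have /rowP/(_ (enum_rank_in WQ W)) := cB; rewrite !mxE => cBW.
  rewrite -[RHS](mulr0 ((-1) ^+ sg)) -[X in _ * X]cBW big_distrr.
  apply: eq_bigr => l _; rewrite mxE /= mulrCA; congr (_ * _).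
  rewrite -det_perm -det_mulmx -row_permE; congr (\det _).
  by apply/matrixP=> x y; rewrite !mxE sgE.
have Y0 t : \sum_j c 0 j * \det (rowsub t (circuit s (V j))) = 0.
  (* The circuit matrix is the inverse Vandermonde matrix times [MY j], so multilinearity in the
     rows expands its minors in those of [MY j] with coefficients independent of [j]. *)
  have YE j : \det (rowsub t (circuit s (V j))) = \sum_(u : {ffun _})
      (\prod_x (rowsub t (invmx (vandermonde n))) x (u x)) *
        \det (rowsub u (MY j)).
    by rewrite -det_mulmx_rowsub mul_rowsub_mx mulKmx ?vandermonde_unit.
  under eq_bigr do rewrite YE big_distrr.
  rewrite exchange_big big1 //= => u _.
  under eq_bigr do rewrite mulrCA.
  by rewrite -big_distrr /= MY0 mulr0.
have [j0 cj0] : exists j, c 0 j != 0.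
  by apply/rV0Pn.
(* For the last [j] with a nonzero coefficient, each earlier [V l] misses a vertex of [e j], so on
   the rows of [e j] only the term of index [j] survives. *)
case: (@arg_maxnP _ j0 (fun j => c 0 j != 0) val cj0) => j cj jmax.
have [t [_ te]] := rep _ (es j).
have := Y0 t; rewrite (bigD1 j) //= big1 ?addr0 => [/eqP | l lj].
  by rewrite mulf_eq0 (negPf cj) (negPf (det_circuit_neq0 _ (eV j) te)).
have [clj | cl0] := boolP (c 0 l != 0); last first.
  by rewrite (eqP (negPn cl0)) mul0r.
rewrite (det_circuit_eq0 (eVl l j _) te) ?mulr0 //.
by rewrite ltn_neqAle; apply/andP; split=> //; apply: jmax.
Qed.

End Circuits.

(** * Colored copies and the lower bound *)

Section Saturation.

Variable d : nat.
Implicit Types (n s r : {ffun 'I_d -> nat}) (R : {fset {ffun 'I_d -> nat}}).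

Notation vtx n := {i : 'I_d & 'I_(n i)}.

Lemma edge_completeP n s (W : {set vtx n}) :
  reflect (forall i, #|W :&: of_color n i| = s i)
    (W \in edges (complete_chypergraph s n)).
Proof. by rewrite inE; apply: (iffP forallP) => Ws i; apply/eqP/Ws. Qed.

Lemma card_color_imset n r (V : {set vtx n}) (f : {v | v \in V} -> vtx r)
    (S : {set {v | v \in V}}) (i : 'I_d) :
    injective f -> (forall v, tag (val v) = tag (f v)) ->
  #|[set val v | v in S] :&: of_color n i| = #|[set f v | v in S] :&: of_color r i|.
Proof.
move=> f_inj f_col; pose S' := [set v in S | tag (f v) == i].
have -> : [set val v | v in S] :&: of_color n i = [set val v | v in S'].
  apply/setP=> v; rewrite inE; apply/andP/imsetP => [[/imsetP[w wS ->]] | [w]].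
    by rewrite inE => wi; exists w; rewrite // inE wS -f_col.
  by rewrite inE => /andP[wS wi] ->; rewrite imset_f // inE f_col.
have -> : [set f v | v in S] :&: of_color r i = [set f v | v in S'].
  apply/setP=> v; rewrite inE; apply/andP/imsetP => [[/imsetP[w wS ->]] | [w]].
    by rewrite inE => wi; exists w; rewrite // inE wS.
  by rewrite inE => /andP[wS wi] ->; rewrite imset_f // inE.
by rewrite (card_imset _ val_inj) (card_imset _ f_inj).
Qed.

Lemma imset_val_preimset (T : finType) (V W : {set T}) :
  W \subset V -> [set val v | v in [set v : {v | v \in V} | val v \in W]] = W.
Proof.
move=> /subsetP WV; apply/setP=> v; apply/imsetP/idP => [[w] | vW].
  by rewrite inE => wW ->.
by exists (exist _ v (WV v vW)); rewrite ?inE.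
Qed.

(** A color-preserving bijection keeps the color counts of vertex subsets, so the edges of the copy
    are all the edges of the complete hypergraph inside [V]. *)
Lemma colored_copy_complete n s r (F E : {set {set vtx n}}) (V : {set vtx n}) :
    @colored_copy d (@spanning d (complete_chypergraph s n) F)
      (complete_chypergraph s r) V E ->
  (forall i, #|V :&: of_color n i| = r i) /\
  (forall W, W \in edges (complete_chypergraph s n) -> W \subset V -> W \in F).
Proof.
case=> /subsetP/= EF _ [f [/= f_bij fE f_col]]; have f_inj := bij_inj f_bij.
split=> [i | W /edge_completeP Ws WV].
  rewrite -[in LHS](imset_val_preimset (subxx V)) (card_color_imset _ _ f_inj f_col).
  rewrite -[RHS](card_of_color r); apply: eq_card => p; rewrite inE andb_idl // => _.
  have [g gK Kg] := f_bij; apply/imsetP; exists (g p); rewrite ?Kg //.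
  by rewrite inE (valP (g p)).
apply: EF; rewrite -(imset_val_preimset WV) fE; apply/edge_completeP => i.
by rewrite -(card_color_imset _ _ f_inj f_col) imset_val_preimset.
Qed.

Lemma complete_colored_copy n s r (F : {set {set vtx n}}) (V : {set vtx n}) :
    (forall i, #|V :&: of_color n i| = r i) ->
    (forall W, W \in edges (complete_chypergraph s n) -> W \subset V -> W \in F) ->
  @colored_copy d (@spanning d (complete_chypergraph s n) F)
    (complete_chypergraph s r) V
    [set W in edges (complete_chypergraph s n) | W \subset V].
Proof.
move=> Vr VF; split=> /=.
- by apply/subsetP=> W; rewrite inE => /andP[]; apply: VF.
- by move=> W; rewrite inE => /andP[].
(* The vertex at position [j] of color [i] goes to the element with index [j] in the enumeration of
   the vertices of [V] of color [i]. *)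
pose h (p : vtx r) : vtx n := enum_val (cast_ord (esym (Vr (tag p))) (tagged p)).
have hP p : h p \in V :&: of_color n (tag p) by apply: enum_valP.
have hV p : h p \in V by have /setIP[] := hP p.
have h_col p : tag (h p) = tag p by have /setIP[_] := hP p; rewrite inE => /eqP.
pose g p : {v | v \in V} := exist _ (h p) (hV p).
have g_inj : injective g.
  move=> [i x] [j y] gxy; have hxy : h (Tagged _ x) = h (Tagged _ y).
    by have := congr1 val gxy.
  have ij : i = j by have := h_col (Tagged _ x); rewrite hxy h_col.
  case: j / ij y gxy hxy => y _ hxy.
  exact: congr1 (cast_ord_inj (enum_val_inj hxy)).
have [|f gK fK] := inj_card_bij g_inj.
  by rewrite card_sig (card_edge Vr).
have f_inj : injective f := can_inj fK.
have f_col v : tag (val v) = tag (f v) by rewrite -[in LHS](fK v) /= h_col.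
exists f; split=> //; first by exists g.
move=> S; rewrite inE andb_idr => [| _]; last first.
  by apply/subsetP=> _ /imsetP[v _ ->]; apply: valP.
by apply/edge_completeP/edge_completeP => Ss i; rewrite -Ss;
  [apply/esym | ]; apply: card_color_imset.
Qed.

(** The edges counted by [q], as vertex sets instead of tuples. Positions start at 0, so avoiding
    the first [r i - s i] of them is a non-strict lower bound. *)
Definition removable n s R : {set {set vtx n}} :=
  [set W in edges (complete_chypergraph s n) |
     [exists r : restrict_family R n,
        [forall v in W, val r (tag v) - s (tag v) <= tagged v]]]%N.

Lemma removableP n s R (W : {set vtx n}) :
  reflect (W \in edges (complete_chypergraph s n) /\
           exists r, [/\ r \in R, forall i, (r i <= n i)%N &
             forall v, v \in W -> (r (tag v) - s (tag v) <= tagged v)%N])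
    (W \in removable n s R).
Proof.
rewrite [W \in removable _ _ _]in_set; apply: (iffP andP) => -[We].
  move=> /existsP[r /'forall_implyP rW]; split=> //; exists (val r).
  by have := valP r; rewrite !inE /= => /andP[rR /forallP rn]; split.
move=> [r [rR rn rW]]; split=> //; apply/existsP.
have rRn : r \in restrict_family R n by rewrite !inE rR; apply/forallP.
by exists [` rRn]%fset; apply/'forall_implyP.
Qed.

Lemma removable_sub n s R :
  removable n s R \subset edges (complete_chypergraph s n).
Proof. by apply/subsetP=> W /removableP[]. Qed.

(** When an edge is added, all edges inside the vertex set of the copy it completes are present.
    Hence no later edge lies in that set, which is the triangularity condition of
    [circuits_bound]. *)
Lemma weakly_saturated_lower n s R (F : {set {set vtx n}}) :
    @weakly_saturated d (complete_chypergraph s n) (complete_family s R) F ->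
  (#|edges (complete_chypergraph s n) :\: F| <= #|removable n s R|)%N.
Proof.
case=> _ [es [es_perm es_sat]]; set K := edges _ in es_perm *.
have es_uniq : uniq es by rewrite (perm_uniq es_perm) enum_uniq.
have es_mem W : W \in es = (W \in K :\: F) by rewrite (perm_mem es_perm) mem_enum.
have /fin_all_exists[V VP] (j : 'I_(size es)) : exists V : {set vtx n},
    [/\ nth set0 es j \subset V,
        exists2 r, r \in R & forall i, #|V :&: of_color n i| = r i
      & forall W, W \in K -> W \subset V -> W \in F :|: [set:: take j.+1 es]].
  have [_ [r rR ->] [V [E [VE jE]]]] := es_sat j (ltn_ord j).
  have [Vr VF] := colored_copy_complete VE.
  by exists V; split=> //; [case: VE => _ /(_ _ jE) | exists r].
have es_K (j : 'I_(size es)) : nth set0 es j \in K :\: F.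
  by rewrite -es_mem mem_nth.
rewrite cardE -(perm_size es_perm).
apply: (circuits_bound (e := fun j : 'I_(size es) => nth set0 es j) (V := V)).
- by move=> j; have /setDP[/edge_completeP] := es_K j.
- by move=> j; have [] := VP j.
- move=> j l ltjl; apply/negP=> lV; have [_ _ VF] := VP j.
  have /setDP[lK lF] := es_K l; have := VF _ lK lV.
  rewrite !inE (negPf lF) /= => /(nthP set0)[m].
  rewrite size_takel // => ltmj; rewrite nth_take // => /eqP.
  rewrite nth_uniq //; last exact: leq_trans ltmj _.
  by move=> /eqP ml; rewrite ml ltnS leqNgt ltjl in ltmj.
- by move=> W /removableP[/edge_completeP].
(* [V j] has exactly [r i] vertices of color [i], so it fits into [n] and its threshold is the one
   in [removable]. *)
- move=> j W Ws WV; have [_ [r rR Vr] _] := VP j.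
  apply/removableP; split; first exact/edge_completeP.
  exists r; split=> // [i | v vW]; last by rewrite -Vr WV.
  by rewrite -Vr -(card_of_color n i) subset_leq_card // subsetIr.
Qed.

(** * The upper bound *)

Lemma sum_color n (W : {set vtx n}) (m : 'I_d -> nat) :
  (\sum_(v in W) m (tag v) = \sum_(i < d) #|W :&: of_color n i| * m i)%N.
Proof.
rewrite (partition_big (fun v : vtx n => tag v) xpredT) //=.
apply: eq_bigr => i _; rewrite -sum_nat_const.
by apply: eq_big => [v | v /andP[_ /eqP->]]; rewrite ?inE.
Qed.

(* Passing from [W] to [W'] trades vertices above the threshold [m] for as many
   vertices of the same color below it. *)
Lemma weight_lt n s (W W' : {set vtx n}) (m : 'I_d -> nat) :
    W \in edges (complete_chypergraph s n) ->
    W' \in edges (complete_chypergraph s n) -> W' != W ->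
    (forall v, v \in W -> m (tag v) <= tagged v)%N ->
    (forall v, v \in W' :\: W -> tagged v < m (tag v))%N ->
  (\sum_(v in W') (tagged v : nat) < \sum_(v in W) (tagged v : nat))%N.
Proof.
move=> /edge_completeP Ws /edge_completeP W's neqW Wm W'm.
have cardW : #|W'| = #|W| by rewrite !card_color_sum; apply: eq_bigr => i _; rewrite Ws.
have mW : (\sum_(v in W') m (tag v) = \sum_(v in W) m (tag v))%N.
  by rewrite !sum_color; apply: eq_bigr => i _; rewrite Ws W's.
rewrite (big_setID W) [X in (_ < X)%N](big_setID W') /= setIC ltn_add2l.
move: mW; rewrite (big_setID W) [RHS](big_setID W') /= setIC => /addnI mD.
apply: (@leq_trans (\sum_(v in W' :\: W) m (tag v))%N); last first.
  by rewrite mD; apply: leq_sum => v /setDP[/Wm].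
(* Each vertex of [W' :\: W] gains at least one unit, and this set is nonempty because [W] and [W']
   are distinct of equal size. *)
apply: (@leq_trans (\sum_(v in W' :\: W) (tagged v).+1)%N); last first.
  by apply: leq_sum => v /W'm.
under [leqRHS]eq_bigr do rewrite -addn1.
rewrite big_split /= sum1_card -addn1 leq_add2l card_gt0 setD_eq0.
by apply: contra neqW => W'W; rewrite eqEcard W'W cardW /=.
Qed.

Lemma card_ord_lt (k m : nat) : (m <= k)%N -> #|[set j : 'I_k | (j < m)%N]| = m.
Proof.
move=> lemk; have w_inj : injective (widen_ord lemk).
  by move=> x y /(congr1 val) /= /val_inj.
rewrite -[RHS]card_ord -cardsT -(card_imset _ w_inj); apply: eq_card => j.
rewrite inE; apply/idP/imsetP => [ltjm | [l _ ->] /=]; last exact: ltn_ord.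
by exists (Ordinal ltjm); rewrite ?inE //; apply: val_inj.
Qed.

Lemma Tagged_imset_of_color n (T : forall i : 'I_d, {set 'I_(n i)}) i :
  [set v : vtx n | tagged v \in T (tag v)] :&: of_color n i
    = [set Tagged (fun i => 'I_(n i)) j | j in T i].
Proof.
apply/setP=> v; rewrite !inE; apply/andP/imsetP => [[] | [j jT ->]] //.
by case: v => i' j /= jT /eqP ii'; case: i / ii'; exists j.
Qed.

Lemma card_Tagged_of_color n (T : forall i : 'I_d, {set 'I_(n i)}) i :
  #|[set v : vtx n | tagged v \in T (tag v)] :&: of_color n i| = #|T i|.
Proof.
rewrite Tagged_imset_of_color card_imset // => j j'.
by move=> /eqP; rewrite eq_Tagged => /eqP.
Qed.

Lemma weakly_saturated_upper n s R :
    (forall r, r \in R -> forall i, s i <= r i)%N ->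
  @weakly_saturated d (complete_chypergraph s n) (complete_family s R)
    (edges (complete_chypergraph s n) :\: removable n s R).
Proof.
move=> sr; set K := edges _; set Q := removable n s R.
split; first exact: subsetDl.
pose wt (W : {set vtx n}) := (\sum_(v in W) (tagged v : nat))%N.
pose le_wt W W' := (wt W <= wt W')%N.
pose es := sort le_wt (enum Q); exists es.
have KQ : K :\: (K :\: Q) = Q by rewrite setDDr setDv set0U; apply/setIidPr/removable_sub.
split; first by rewrite KQ perm_sort.
have es_sorted : sorted le_wt es by apply: sort_sorted => W W'; apply: leq_total.
have es_mem W : W \in es = (W \in Q) by rewrite mem_sort mem_enum.
move=> i lti; set W := nth set0 es i.
have WQ : W \in Q by rewrite -es_mem mem_nth.
have Wtake : W \in take i.+1 es.
  by rewrite -[W](nth_take set0 (ltnSn i)) mem_nth // size_takel.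
have /removableP[WK [r [rR rn rW]]] := WQ.
exists (complete_chypergraph s r); first by exists r.
pose T i := [set j : 'I_(n i) | j < r i - s i]%N.
(* [W] avoids the added positions, so [V] has [s i + (r i - s i) = r i] vertices of color [i]. *)
pose V := W :|: [set v : vtx n | tagged v \in T (tag v)].
have disWT : W :&: [set v : vtx n | tagged v \in T (tag v)] = set0.
  apply/setP=> v; rewrite !inE; apply/negP=> /andP[/rW].
  by rewrite leqNgt => /negPf->.
exists V, [set W in K | W \subset V]; split; last first.
  by rewrite inE WK subsetUl.
apply: complete_colored_copy => [l | W' W'K W'V].
  rewrite setIUl cardsU -setIIl disWT set0I cards0 subn0.
  have /edge_completeP-> := WK.
  rewrite card_Tagged_of_color card_ord_lt ?subnKC ?sr //.
  exact: leq_trans (leq_subr _ _) (rn l).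
rewrite in_setU in_setD W'K andbT; have [W'Q /= | //] := boolP (W' \in Q).
rewrite inE.
have [-> // | neqW] := eqVneq W' W.
(* The vertices of [W'] outside [W] are added ones, below the threshold. Since [W'] is strictly
   lighter, it precedes [W] however ties are sorted. *)
have ltwt : (wt W' < wt W)%N.
  apply: (weight_lt (m := fun i => r i - s i)%N WK W'K neqW rW) => v /setDP[/(subsetP W'V)].
  by rewrite !inE => /orP[-> | ].
have W'es : W' \in es by rewrite es_mem.
rewrite in_take_leq // ltnS leqNgt; apply/negP=> lt_i.
move: ltwt; rewrite ltnNge => /negP; apply.
have := sorted_ltn_nth (leT := le_wt) _ set0 es_sorted _ _ lti _ lt_i.
rewrite nth_index ?inE ?index_mem //; apply=> //.
by move=> ? ? ?; apply: leq_trans.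
Qed.

(** * Tuples of subsets as edges, and the final count *)

Definition dffun_set n (T : {dffun forall i : 'I_d, {set 'I_(n i)}}) : {set vtx n} :=
  [set v : vtx n | tagged v \in T (tag v)].

Lemma dffun_set_inj n : injective (@dffun_set n).
Proof.
move=> T T' /setP eqT; apply/ffunP=> i; apply/setP=> j.
by have := eqT (Tagged (fun i => 'I_(n i)) j); rewrite !inE.
Qed.

Lemma dffun_set_surj n (W : {set vtx n}) : exists T, W = dffun_set T.
Proof.
exists [ffun i => [set j | Tagged (fun i => 'I_(n i)) j \in W]].
by apply/setP=> -[i j]; rewrite inE /= ffunE inE.
Qed.

Lemma dffun_set_edge n s (T : {dffun forall i : 'I_d, {set 'I_(n i)}}) :
  (dffun_set T \in edges (complete_chypergraph s n)) = [forall i, #|T i| == s i].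
Proof.
apply/edge_completeP/forallP => Ts i.
  by rewrite -(Ts i) (card_Tagged_of_color T).
by rewrite (card_Tagged_of_color T); apply/eqP.
Qed.

Lemma card_edges_complete n s :
  #|edges (complete_chypergraph s n)| = (\prod_(i < d) 'C(n i, s i))%N.
Proof.
pose A i := [pred B : {set 'I_(n i)} | #|B| == s i].
transitivity #|(family A : simpl_pred {dffun forall i : 'I_d, {set 'I_(n i)}})|.
  rewrite -(card_imset _ (@dffun_set_inj n)); apply: eq_card => W.
  apply/idP/imsetP => [|[T /familyP TA ->]].
    have [T ->] := dffun_set_surj W; rewrite dffun_set_edge => /forallP Ts.
    by exists T => //; apply/familyP.
  by rewrite dffun_set_edge; apply/forallP=> i; apply: TA.
rewrite card_family foldrE big_map big_enum /=; apply: eq_bigr => i _.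
by rewrite -[in RHS](card_ord (n i)) -card_draws; apply: eq_card => B; rewrite !inE.
Qed.

Lemma card_removable n s R : q n s R = #|removable n s R|.
Proof.
rewrite /q -(card_imset _ (@dffun_set_inj n)); apply: eq_card => W.
have [T ->] := dffun_set_surj W; rewrite (mem_imset _ _ (@dffun_set_inj n)).
rewrite [LHS]in_set [RHS]in_set dffun_set_edge.
rewrite [X in X && _ = _](_ : _ = [forall i, #|T i| == s i]); last first.
  by apply: eq_forallb => i; rewrite inE subsetT.
apply: andb_id2l => /forallP Ts; apply: eq_existsb => r.
apply/forallP/'forall_implyP => [Tr v | Tr i].
  rewrite inE => vT; have := Tr (tag v); rewrite inE => /andP[/subsetP/(_ _ vT)].
  by rewrite !inE andbT -leqNgt.
rewrite inE Ts andbT; apply/subsetP=> j jT; rewrite !inE andbT -leqNgt.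
by apply: (Tr (Tagged (fun i => 'I_(n i)) j)); rewrite inE.
Qed.

End Saturation.

Local Close Scope ring_scope.

Theorem theorem1p3 (d : nat) (d_gt0 : 0 < d)
    (n s : {ffun 'I_d -> nat}) (R : {fset {ffun 'I_d -> nat}})
    (R_neq0 : R != fset0)
    (s_le : forall r, r \in R -> forall i : 'I_d, (s i <= n i) /\ (s i <= r i)) :
  ((cwsat (complete_chypergraph s n) (complete_family s R))%:Z =
    (\prod_(i < d) 'C(n i, s i))%N%:Z - (q n s R)%:Z)%R.
Proof.
rewrite card_removable -card_edges_complete.
set K := edges _; set Q := removable n s R.
have subK (F : {set {set complete_chypergraph s n}}) :
    F \subset K -> #|F| + #|K :\: F| = #|K|.
  by move=> FK; rewrite -[RHS](cardsID F) (setIidPr FK).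
have QK : Q \subset K := removable_sub n s R.
rewrite /cwsat; case: ex_minnP => m /asboolP[F [FK Fes] <-] minF.
have low := weakly_saturated_lower (conj FK Fes).
have s_le_r r : r \in R -> forall i, s i <= r i.
  by move=> rR i; have [] := s_le r rR i.
have up : #|F| <= #|K :\: Q|.
  apply: minF; apply/asboolP; exists (K :\: Q) => //.
  exact: weakly_saturated_upper.
(* As [Q] lies in [K], the claim becomes [#|F| = #|K :\: Q|]. Minimality of [F] gives one inequality
   and [low] the other. *)
rewrite -(subK Q QK) addnC PoszD addrK; congr Posz.
apply/eqP; rewrite eqn_leq up /= -(leq_add2l #|Q|) subK // -(subK F FK) addnC.
by rewrite leq_add2r.
Qed.
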